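(* Let $(X,\succcurlyeq^X)$, $(Y,\succcurlyeq^Y)$, $(U,\succcurlyeq^U)$ and $(V,\succcurlyeq^V)$ be partially ordered vector spaces. Let $C$ be an $\succcurlyeq^X$-chain-complete subset of $X$ and $D$ a nonempty subset of $Y$. Let $f:C\to L(X,U)$, $g:D\to L(Y,V)$ and $A:X\to Y$ be (not necessarily linear) mappings. Suppose that the following conditions hold: (1) $f$ and $g$ are both order-positive; (2) for every $x\in C$, the set $\pi({}_fA_g)(x)$ is a nonempty universally inductive subset of $C$; (3) there are elements $x'\in C$ and $u'\in \pi({}_fA_g)(x')$ satisfying $x'\preccurlyeq^X u'$; (4) $A$ is order-increasing. Then the nonlinear split ordered variational inequality problem $\mathrm{NSOVI}(f,C,U,A,g,D,V)$ has a solution. Moreover, its solution set $\mathcal{S}(f,A,g)$ satisfies: (i) $(\mathcal{S}(f,A,g),\succcurlyeq^X)$ is a nonempty inductive poset; (ii) $(\mathcal{S}(f,A,g)\cap[x'),\succcurlyeq^X)$ is a nonempty inductive poset. Consequently: (i)' $\mathrm{NSOVI}(f,C,U,A,g,D,V)$ has an $\succcurlyeq^X$-maximal solution; (ii)' $\mathrm{NSOVI}(f,C,U,A,g,D,V)$ has an $\succcurlyeq^X$-maximal solution $x^*$ with $x^*\succcurlyeq^X x'$.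
   Context: All vector spaces are real. A partially ordered vector space is a vector space $X$ with a partial order $\succcurlyeq$ such that $x\succcurlyeq y$ implies $x+z\succcurlyeq y+z$ for all $x,y,z\in X$, and $x\succcurlyeq y$ implies $\alpha x\succcurlyeq\alpha y$ for all $x,y\in X$ and real $\alpha\ge 0$. We write $x\preccurlyeq y$ for $y\succcurlyeq x$, and $[x')=\{x\in X: x\succcurlyeq^X x'\}$. For vector spaces $X,Y$, $L(X,Y)$ denotes the space of linear operators from $X$ to $Y$ (no continuity). Order notions. A chain is a nonempty totally ordered subset. A nonempty subset $S$ of a poset $(P,\succcurlyeq)$ is chain-complete if every chain contained in $S$ has a smallest upper bound in $S$ (least upper bound taken within the poset $S$). A poset is inductive if every chain in it has an upper bound in it. A subset $S$ of a poset $P$ is universally inductive in $P$ if every chain $\{x_\alpha\}\subseteq P$ such that each $x_\beta\in\{x_\alpha\}$ has some $s\in S$ with $s\succcurlyeq x_\beta$ has an upper bound in $S$. ''Universally inductive subset of $C$'' means universally inductive in the poset $(C,\succcurlyeq^X)$. A mapping $f:C\to L(X,U)$, with $C\subseteq X$ nonempty, is order-positive if, for all $x,y\in C$ with $x\preccurlyeq^X y$ and every $z\in X$, $f(x)(z)\succcurlyeq^U 0$ implies $f(y)(z)\succcurlyeq^U 0$. Order-positivity of $g:D\to L(Y,V)$ is defined in the same way with $(Y,\succcurlyeq^Y)$, $(V,\succcurlyeq^V)$ and $D$. The mapping $A:X\to Y$ is order-increasing if $x\preccurlyeq^X y$ implies $Ax\preccurlyeq^Y Ay$. The problem $\mathrm{NSOVI}(f,C,U,A,g,D,V)$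 is: find $x_*\in C$ such that $f(x_* )(x-x_* )\succcurlyeq^U 0$ for all $x\in C$, and such that $y_*=Ax_*$ belongs to $D$ and satisfies $g(y_* )(y-y_* )\succcurlyeq^V 0$ for all $y\in D$. Such an $x_*$ is called a solution, and $\mathcal{S}(f,A,g)\subseteq C$ denotes the set of solutions. An $\succcurlyeq^X$-maximal solution is a maximal element of $(\mathcal{S}(f,A,g),\succcurlyeq^X)$. For $x\in C$, $$\pi({}_fA_g)(x)=\{z\in C:\ f(x)(z)=\wedge\{f(x)(t):t\in C\}\ \text{and}\ g(Ax)(Az)=\wedge\{g(Ax)(s):s\in D\}\},$$ where $\wedge$ denotes the smallest element of the indicated subset of $(U,\succcurlyeq^U)$, resp. $(V,\succcurlyeq^V)$ (the equality includes the requirement that the smallest element exists). Since $g$ is defined only on $D$, hypothesis (2) implicitly includes that $Ax\in D$ for every $x\in C$. *)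

(* Defs.v *)
From HB Require Import structures.
From mathcomp Require Import all_boot all_order all_algebra.
From mathcomp Require Import boolp classical_sets reals.

Set Implicit Arguments.
Unset Strict Implicit.
Unset Printing Implicit Defensive.

Import Order.TTheory GRing.Theory Num.Theory.

Local Open Scope classical_set_scope.
Local Open Scope ring_scope.

(* The order is a boolean relation only because MathComp orders are; under the
   classical axioms of boolp this is no restriction. *)
HB.mixin Record isPOrderedLmodule (R : numDomainType) V
    of GRing.Lmodule R V & Num.POrderedZmodule V := {
  lev_add2r : forall x y z : V, y <= x -> y + z <= x + z;
  lev_scale2l : forall (a : R) (x y : V), 0 <= a -> y <= x -> a *: y <= a *: x
}.

#[short(type="porderLmodType")]
HB.structure Definition POrderedLmodule (R : numDomainType) :=
  { V of isPOrderedLmodule R V & GRing.Lmodule R V & Num.POrderedZmodule V }.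

Section OrderNotions.
Context {d : Order.disp_t} {T : porderType d}.
Implicit Types (S P K : set T) (x m : T).

Definition chain K := K !=set0 /\ total_on K (fun x y => (x <= y)%O).

Definition smallest_element S m := S m /\ lbound S m.

Definition maximal_element S m := S m /\ forall x, S x -> (m <= x)%O -> x = m.

(* The least upper bound is taken inside the poset S: only upper bounds that
   belong to S compete. *)
Definition chain_complete S :=
  S !=set0 /\
  forall K, chain K -> K `<=` S ->
    exists m, smallest_element (S `&` ubound K) m.

Definition inductive_poset P :=
  forall K, chain K -> K `<=` P -> exists m, P m /\ ubound K m.

Definition universally_inductive P S :=
  S `<=` P /\
  forall K, chain K -> K `<=` P ->
    (forall x, K x -> exists s, S s /\ (x <= s)%O) ->
    exists s, S s /\ ubound K s.

End OrderNotions.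

(* The maps f : C -> L(X, U) and g : D -> L(Y, V) are genuinely partial: their
   sources are the subtypes of X and Y attached to the sets C and D. *)
Definition order_positive (R : numDomainType) (X U : porderLmodType R)
    (C : set X) (f : C -> {linear X -> U}) :=
  forall x y : C, \val x <= \val y ->
    forall z : X, 0 <= f x z -> 0 <= f y z.

Section NSOVI.
Context {R : numDomainType} {X Y U V : porderLmodType R}.
Variables (C : set X) (D : set Y).
Variables (f : C -> {linear X -> U}) (g : D -> {linear Y -> V}) (A : X -> Y).

(* g (A x) makes sense only if A x lies in D, whence the y : D with
   \val y = A x; a nonempty value of this map entails that A x lies in D. *)
Definition NSOVI_pi (x : C) : set X :=
  [set z | [/\ C z,
    smallest_element [set f x t | t in C] (f x z) &
    exists2 y : D, \val y = A (\val x) &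
      smallest_element [set g y s | s in D] (g y (A z))]].

Definition NSOVI_solution (x : C) :=
  (forall t, C t -> 0 <= f x (t - \val x)) /\
  exists2 y : D, \val y = A (\val x) &
    forall s, D s -> 0 <= g y (s - \val y).

Definition NSOVI_solutions : set X := [set \val x | x in NSOVI_solution].

End NSOVI.

(* Main.v *)
Require Import Defs.
From HB Require Import structures.
From mathcomp Require Import all_boot all_order all_algebra.
From mathcomp Require Import boolp classical_sets reals.

Set Implicit Arguments.
Unset Strict Implicit.
Unset Printing Implicit Defensive.

Import Order.TTheory GRing.Theory Num.Theory.

Local Open Scope classical_set_scope.
Local Open Scope ring_scope.

(** The theorem is an order-theoretic fixed point theorem for the set-valued
    map [pi = NSOVI_pi f g A].

    By linearity, [z] minimizes [f x] over [C] iff [f x (t - z)] is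
    nonnegative for every [t] in [C], and similarly for [g (A x)]. Hence the
    solutions are exactly the fixed points [x \in pi x]
    ([NSOVI_solutions_fixed]), and order-positivity, which preserves the
    nonnegativity of [f x (t - z)] when [x] grows, makes [pi] monotone for
    inclusion ([NSOVI_pi_mono]).

    For a monotone [F] whose values are universally inductive in a
    chain-complete [C], consider the set [progressive F] of the [x] in [C] lying
    below some element of [F x]. It contains the fixed points and the given [x'], and
    every chain in it has an upper bound in it, namely its supremum
    ([progressive_inductive]). Its maximal elements are fixed points
    ([maximal_progressive]), hence maximal fixed points.
    Zorn's lemma in this single set then gives all the conclusions: a maximal
    element above [x'] is a maximal solution above [x'], and one above the
    supremum of a chain of solutions is a solution bounding that chain. *)

Section Posets.
Context {d : Order.disp_t} {T : porderType d}.
Implicit Types (S P K : set T) (x m : T).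

(** Zorn's lemma inside the part of [P] above [x], which is again inductive; an
    element maximal there is maximal in [P], since whatever exceeds it is also
    above [x]. *)
Lemma Zorn_above P x : inductive_poset P -> P x ->
  exists m, maximal_element P m /\ (x <= m)%O.
Proof.
move=> indP Px; pose up := {y : T | P y /\ (x <= y)%O}.
have [] := @Zorn up (fun y z => sval y <= sval z)%O.
- by move=> y; exact: lexx.
- by move=> y z t; exact: le_trans.
- move=> [y py] [z pz] /= yz zy.
  have eyz : y = z by apply/le_anti/andP.
  by case: z / eyz pz {yz zy} => pz; rewrite (Prop_irrelevance py pz).
- move=> K totK; have [[k Kk]|K0] := pselect (K !=set0); last first.
    (* [inductive_poset] bounds nonempty chains only; [x] bounds the empty one. *)
    exists (exist _ x (conj Px (lexx x))) => s Ks.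
    by case: K0; exists s.
  have [|_ [s _ <-]|m [Pm ubm]] := indP [set sval s | s in K].
  + split; first by exists (sval k), k.
    by move=> _ _ [s Ks <-] [t Kt <-]; exact: totK.
  + by case: (svalP s).
  + have xm : (x <= m)%O.
      by apply: le_trans (svalP k).2 _; apply: ubm; exists k.
    by exists (exist _ m (conj Pm xm)) => s Ks; apply: ubm; exists s.
- move=> [m [Pm xm]] /= maxm; exists m; split=> //; split=> // y Py my.
  have := maxm (exist _ y (conj Py (le_trans xm my))) my.
  by move=> /(congr1 sval).
Qed.

(** Chains are nonempty, so a bound of a chain of elements above [x] is itself
    above [x]. *)
Lemma inductive_poset_above S x : inductive_poset S ->
  inductive_poset (S `&` [set y | (x <= y)%O]).
Proof.
move=> indS K chK KS; have [[k Kk] _] := chK.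
have [|m [Sm ubm]] := indS K chK; first by move=> y /KS[].
exists m; split=> //; split=> //=.
by apply: le_trans (ubm k Kk); have [] := KS k Kk.
Qed.

End Posets.

(** * Fixed points of monotone set-valued maps *)

Section FixedPoints.
Context {d : Order.disp_t} {T : porderType d}.
Variables (C : set T) (F : C -> set T).

Definition fixed_points : set T := [set \val x | x in [set x : C | F x (\val x)]].

Definition progressive : set T :=
  [set \val x | x in [set x : C | exists2 z, F x z & (\val x <= z)%O]].

Hypothesis Fmono : forall x y : C, (\val x <= \val y)%O -> F x `<=` F y.
Hypothesis Fuind : forall x : C, universally_inductive C (F x).

Lemma fixed_points_progressive : fixed_points `<=` progressive.
Proof. by move=> _ [x Fx <-]; exists x => //; exists (\val x). Qed.

(** For a chain [K] with supremum [m], monotonicity puts a majorant of each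
    element of [K] inside the single set [F m]; universal inductivity of [F m]
    then bounds all of [K] by one element of [F m], which lies above [m]
    because [m] is the least upper bound. *)
Lemma progressive_inductive : chain_complete C -> inductive_poset progressive.
Proof.
move=> [_ ccC] K chK Kprog.
have KC : K `<=` C by move=> _ /Kprog[x _ <-]; exact: set_valP.
have [m [[Cm ubm] lbm]] := ccC K chK KC.
exists m; split=> //; pose c : C := SigSub (mem_set Cm).
exists c => //=.
have [//|//||s [Fs ubs]] := (Fuind c).2 K.
  move=> y Ky; have [x [z Fxz xz] xy] := Kprog y Ky.
  exists z; rewrite -xy; split=> //; apply: Fmono Fxz.
  by rewrite xy; exact: ubm.
by exists s => //; apply: lbm; split=> //; exact: (Fuind c).1.
Qed.

(** If [m <= z] with [z] in [F m], then [z] is in [F z] by monotonicity, so [z]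
    is progressive and maximality forces [z = m]. Maximality is inherited by
    the smaller set of fixed points. *)
Lemma maximal_progressive m :
  maximal_element progressive m -> maximal_element fixed_points m.
Proof.
move=> [[x [z Fxz xz] <-] maxx]; split; last first.
  by move=> y /fixed_points_progressive; exact: maxx.
pose c : C := SigSub (mem_set ((Fuind x).1 z Fxz)).
have Fcz : F c z by apply: Fmono (Fxz).
have zx : z = \val x by apply: maxx => //; exists c => //; exists z.
by exists x => //=; rewrite -zx.
Qed.

Lemma maximal_fixed_point_above x : chain_complete C -> progressive x ->
  exists m, maximal_element fixed_points m /\ (x <= m)%O.
Proof.
move=> /progressive_inductive indP /(Zorn_above indP)[m [maxm xm]].
by exists m; split=> //; exact: maximal_progressive.
Qed.

Lemma fixed_points_inductive : chain_complete C -> inductive_poset fixed_points.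
Proof.
move=> ccC K chK Kfix.
have [|s [Ps ubs]] := progressive_inductive ccC chK.
  exact: subset_trans Kfix fixed_points_progressive.
have [m [[Fm _] sm]] := maximal_fixed_point_above ccC Ps.
by exists m; split=> // y /ubs ys; exact: le_trans sm.
Qed.

End FixedPoints.

(** * The split variational inequality as a fixed point problem *)

(** This turns minimality of [h z], which compares two values of [h], into the
    sign of single values of [h]: the only thing order-positivity can see. *)
Lemma smallest_linear_image (R : numDomainType) (X U : porderLmodType R)
    (S : set X) (h : {linear X -> U}) (z : X) : S z ->
  smallest_element [set h t | t in S] (h z) <->
  forall t, S t -> 0 <= h (t - z).
Proof.
have subv_ge0 (a b : U) : 0 <= a - b <-> b <= a.
  split=> [ab|ba]; last by rewrite -(subrr b) lev_add2r.
  by rewrite -[a](subrK b) -[leLHS]add0r lev_add2r.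
move=> Sz; split=> [[_ lb] t St|pos].
  by rewrite raddfB; apply/subv_ge0; apply: lb; exists t.
split; first by exists z.
by move=> _ [t St <-]; apply/subv_ge0; rewrite -raddfB; exact: pos.
Qed.

Section Solutions.
Context {R : numDomainType} {X Y U V : porderLmodType R}.
Variables (C : set X) (D : set Y).
Variables (f : C -> {linear X -> U}) (g : D -> {linear Y -> V}) (A : X -> Y).
Hypothesis AD : forall x : C, D (A (\val x)).

Lemma NSOVI_piE (x : C) (z : X) : NSOVI_pi f g A x z <->
  [/\ C z, forall t, C t -> 0 <= f x (t - z) &
    exists2 y : D, \val y = A (\val x) & forall s, D s -> 0 <= g y (s - A z)].
Proof.
have Dz : C z -> D (A z) by move=> Cz; exact: (AD (SigSub (mem_set Cz))).
split=> -[Cz fz [y yE gy]]; split=> //; try (exists y => //).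
- exact/smallest_linear_image.
- by apply/smallest_linear_image => //; exact: Dz.
- exact/smallest_linear_image.
- by apply/smallest_linear_image => //; exact: Dz.
Qed.

Lemma NSOVI_solutions_fixed :
  NSOVI_solutions f g A = fixed_points (NSOVI_pi f g A).
Proof.
apply/seteqP; split=> _ [x xsol <-]; exists x => //.
  case: xsol => fx [y yE gy]; apply/NSOVI_piE; split=> //; first exact: set_valP.
  by exists y; rewrite -?yE.
move/NSOVI_piE: xsol => [_ fx [y yE gy]]; split=> //.
by exists y; rewrite ?yE.
Qed.

Lemma NSOVI_pi_mono : order_positive f -> order_positive g ->
  {homo A : x y / x <= y} ->
  forall x y : C, \val x <= \val y -> NSOVI_pi f g A x `<=` NSOVI_pi f g A y.
Proof.
move=> fpos gpos Amono x y xy z /NSOVI_piE[Cz fz [a aE ga]].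
apply/NSOVI_piE; split=> // [t Ct|]; first exact: fpos xy _ (fz t Ct).
exists (SigSub (mem_set (AD y))) => // s Ds.
by apply: gpos (ga s Ds); rewrite aE; exact: Amono.
Qed.

End Solutions.

Theorem theorem3p2 (R : realType) (X Y U V : porderLmodType R)
    (C : set X) (D : set Y)
    (f : C -> {linear X -> U}) (g : D -> {linear Y -> V}) (A : X -> Y)
    (x' : C) (u' : X) :
  chain_complete C ->
  D !=set0 ->
  order_positive f -> order_positive g ->
  (forall x : C, NSOVI_pi f g A x !=set0 /\
                 universally_inductive C (NSOVI_pi f g A x)) ->
  NSOVI_pi f g A x' u' -> \val x' <= u' ->
  {homo A : x y / x <= y} ->
  [/\ exists x : C, NSOVI_solution f g A x,
      NSOVI_solutions f g A !=set0 /\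
        inductive_poset (NSOVI_solutions f g A),
      NSOVI_solutions f g A `&` [set x | \val x' <= x] !=set0 /\
        inductive_poset (NSOVI_solutions f g A `&` [set x | \val x' <= x]),
      exists x, maximal_element (NSOVI_solutions f g A) x &
      exists x, maximal_element (NSOVI_solutions f g A) x /\ \val x' <= x].
Proof.
move=> ccC _ fpos gpos pi_uind piu x'u Amono.
have AD (x : C) : D (A (\val x)).
  by have [[z [_ _ [y <- _]]] _] := pi_uind x; exact: set_valP.
have pi_mono := NSOVI_pi_mono AD fpos gpos Amono.
have uind x := (pi_uind x).2.
have x'prog : progressive (NSOVI_pi f g A) (\val x').
  by exists x' => //; exists u'.
have := maximal_fixed_point_above pi_mono uind ccC x'prog.
have := fixed_points_inductive pi_mono uind ccC.
rewrite -(NSOVI_solutions_fixed f g AD) => indS [m [maxm x'm]].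
have Sm := maxm.1.
split.
- by have [x xsol _] := Sm; exists x.
- by split=> //; exists m.
- by split; [exists m | exact: inductive_poset_above].
- by exists m.
- by exists m.
Qed.
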